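(* Let $A$ be an algebra of $\mathcal{V}$ such that $K(A)$ is closed under the commutator operation. If $A$ satisfies the condition $(\star)$, then $A$ is congruence normal if and only if $L(A)$ is a normal lattice.
   Context: $\mathcal{V}$ is a fixed congruence-modular variety of algebras (of a finite signature) that is semidegenerate: no nontrivial algebra in $\mathcal{V}$ has one-element subalgebras (equivalently, $\nabla_A$ is compact in $Con(A)$ for every $A\in\mathcal{V}$). For $A\in\mathcal{V}$, $Con(A)$ is the complete lattice of congruences of $A$, with least element $\Delta_A$ and greatest element $\nabla_A$; $K(A)$ is the set of compact (= finitely generated) congruences. Commutator: $[\cdot,\cdot]=[\cdot,\cdot]_A$ is the (modular) commutator, i.e. the greatest operation on the congruence lattices of members of $\mathcal{V}$ such that for every surjective morphism $f:A\to B$ in $\mathcal{V}$ and all $\alpha,\beta\in Con(A)$: $[\alpha,\beta]_A\subseteq\alpha\cap\beta$ and $[\alpha,\beta]_A\vee Ker(f)=f^{-1}([f(\alpha\vee Ker(f)),f(\beta\vee Ker(f))]_B)$. Iterates: $[\alpha,\alpha]^0=\alpha$, $[\alpha,\beta]^1=[\alpha,\beta]$, $[\alpha,\beta]^{n+1}=[[\alpha,\beta]^n,[\alpha,\beta]^n]$. Condition $(\star)$: for all $\alpha,\beta\in K(A)$ and every integer $n\geq 1$ there is an integer $m\geq 0$ with $[[\alpha,\alpha]^m,[\beta,\beta]^m]\subseteq[\alpha,\beta]^n$. Prime congruences and radical: $\phi\in Con(A)\setminus\{\nabla_A\}$ is prime if $[\alpha,\beta]\subseteq\phi$ implies $\alpha\subseteq\phi$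 or $\beta\subseteq\phi$ (for $\alpha,\beta\in Con(A)$); $Spec(A)$ is the set of prime congruences; $\rho(\theta)=\bigcap\{\phi\in Spec(A)\mid\theta\subseteq\phi\}$. Reticulation: when $K(A)$ is closed under the commutator, $L(A)=K(A)/{\equiv}$ where $\alpha\equiv\beta$ iff $\rho(\alpha)=\rho(\beta)$; $\lambda_A:K(A)\to L(A)$ is the quotient map; $L(A)$ is a bounded distributive lattice with $\lambda_A(\alpha)\vee\lambda_A(\beta)=\lambda_A(\alpha\vee\beta)$, $\lambda_A(\alpha)\wedge\lambda_A(\beta)=\lambda_A([\alpha,\beta])$, $0=\lambda_A(\Delta_A)$, $1=\lambda_A(\nabla_A)$. $A$ is congruence normal if for all $\theta,\nu\in Con(A)$ with $\theta\vee\nu=\nabla_A$ there exist $\alpha,\beta\in Con(A)$ with $\theta\vee\alpha=\nu\vee\beta=\nabla_A$ and $[\alpha,\beta]=\Delta_A$. A bounded distributive lattice $L$ is normal if for all $a,b\in L$ with $a\vee b=1$ there exist $e,f\in L$ with $a\vee e=b\vee f=1$ and $e\wedge f=0$. *)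

(* Defs.v *)
From HB Require Import structures.
From mathcomp Require Import all_boot all_order.
From mathcomp Require Import boolp classical_sets.

Set Implicit Arguments.
Unset Strict Implicit.
Unset Printing Implicit Defensive.

Import Order.TTheory.

Local Open Scope quotient_scope.
Local Open Scope classical_set_scope.
Local Open Scope order_scope.

Record signature := Signature {
  symb : finType;
  arity : symb -> nat
}.

Record algebra (sg : signature) := Algebra {
  carrier :> Type;
  op : forall f : symb sg, ('I_(arity f) -> carrier) -> carrier;
  carrier_inhabited : inhabited carrier
}.
Arguments op {sg a} f x.

Record hom (sg : signature) (A B : algebra sg) := Hom {
  hom_fun :> A -> B;
  hom_op : forall (f : symb sg) (x : 'I_(arity f) -> A),
    hom_fun (op f x) = op f (hom_fun \o x)
}.

Definition surjective (T U : Type) (h : T -> U) : Prop :=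
  forall u, exists t, h t = u.

Section Product.
Variables (sg : signature) (I : Type) (A : I -> algebra sg).

Lemma prod_inhabited : inhabited (forall i, A i).
Proof.
have ex i : exists _ : A i, True.
  by have [a] := carrier_inhabited (A i); exists a.
by constructor=> i; exact: proj1_sig (cid (ex i)).
Qed.

Definition prod_algebra : algebra sg :=
  Algebra (fun f (x : 'I_(arity f) -> forall i, A i) i => op f (x^~ i))
          prod_inhabited.
End Product.

(* Closure under S is stated up to isomorphism: a subalgebra of B is the      *)
(* source of an injective homomorphism into B.                                *)
Record variety (sg : signature) := Variety {
  in_variety :> algebra sg -> Prop;
  variety_image : forall (A B : algebra sg) (h : hom A B),
    surjective h -> in_variety A -> in_variety B;
  variety_sub : forall (A B : algebra sg) (h : hom A B),
    injective h -> in_variety B -> in_variety A;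
  variety_prod : forall (I : Type) (A : I -> algebra sg),
    (forall i, in_variety (A i)) -> in_variety (prod_algebra A)
}.

Fact con_display : Order.disp_t. Proof. exact: Order.Disp tt tt. Qed.
Fact ret_display : Order.disp_t. Proof. exact: Order.Disp tt tt. Qed.

Section Congruence.
Variables (sg : signature) (A : algebra sg).

Record con := Con {
  con_rel :> A -> A -> Prop;
  con_refl : forall x, con_rel x x;
  con_sym : forall x y, con_rel x y -> con_rel y x;
  con_trans : forall x y z, con_rel x y -> con_rel y z -> con_rel x z;
  con_op : forall (f : symb sg) (x y : 'I_(arity f) -> A),
    (forall i, con_rel (x i) (y i)) -> con_rel (op f x) (op f y)
}.

HB.instance Definition _ := gen_eqMixin con.
HB.instance Definition _ := gen_choiceMixin con.

Lemma conP (a b : con) : (forall x y, a x y <-> b x y) -> a = b.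
Proof.
case: a b => [r r1 r2 r3 r4] [s s1 s2 s3 s4] /= rs.
have rsE : r = s by apply/funext => x; apply/funext => y; apply/propext.
by case: _ / rsE s1 s2 s3 s4 {rs} => *; congr Con; apply: Prop_irrelevance.
Qed.

Definition con_le (a b : con) : bool := `[< forall x y, a x y -> b x y >].

Fact con_le_refl : reflexive con_le.
Proof. by move=> a; apply/asboolP. Qed.

Fact con_le_anti : antisymmetric con_le.
Proof.
move=> a b /andP[/asboolP ab /asboolP ba].
by apply: conP => x y; split; [apply: ab | apply: ba].
Qed.

Fact con_le_trans : transitive con_le.
Proof.
move=> b a c /asboolP ab /asboolP bc; apply/asboolP => x y /ab; exact: bc.
Qed.

HB.instance Definition _ := Order.Le_isPOrder.Build con_display con
  con_le_refl con_le_anti con_le_trans.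

Lemma con_leP (a b : con) : reflect (forall x y, a x y -> b x y) (a <= b).
Proof. exact: asboolP. Qed.

Definition con_inf (S : set con) : con.
Proof.
exists (fun x y => forall a, S a -> a x y).
- by move=> x a _; apply: con_refl.
- by move=> x y xy a Sa; apply/con_sym/xy.
- by move=> x y z xy yz a Sa; apply: con_trans (xy a Sa) (yz a Sa).
- by move=> f x y xy a Sa; apply: con_op => i; apply: xy.
Defined.

Definition con_sup (S : set con) : con :=
  con_inf [set b | forall a, S a -> a <= b].

Lemma con_infP (S : set con) (b : con) :
  reflect (forall a, S a -> b <= a) (b <= con_inf S).
Proof.
apply: (iffP (con_leP _ _)) => [h a Sa|h x y bxy a Sa].
  by apply/con_leP => x y /h; apply.
by have /con_leP := h a Sa; apply.
Qed.

Lemma con_supP (S : set con) (b : con) :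
  reflect (forall a, S a -> a <= b) (con_sup S <= b).
Proof.
apply: (iffP idP) => [h a Sa|h].
  by apply: le_trans h; apply/con_infP => c; apply.
by apply/con_leP => x y; apply.
Qed.

Definition con_meet (a b : con) : con := con_inf [set a; b].
Definition con_join (a b : con) : con := con_sup [set a; b].

Fact con_meetP a b c : (a <= con_meet b c) = (a <= b) && (a <= c).
Proof.
apply/con_infP/andP => [h|[ab ac] d [->|->]//].
by split; apply: h; [left | right].
Qed.

Fact con_joinP a b c : (con_join a b <= c) = (a <= c) && (b <= c).
Proof.
apply/con_supP/andP => [h|[ab ac] d [->|->]//].
by split; apply: h; [left | right].
Qed.

HB.instance Definition _ := Order.POrder_MeetJoin_isLattice.Build
  con_display con con_meetP con_joinP.

Definition con_bot : con.
Proof.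
exists eq => //; first by move=> x y z ->.
by move=> f x y xy; congr op; apply/funext.
Defined.

Definition con_top : con.
Proof. by exists (fun _ _ => True). Defined.

Fact con_bot_le a : con_bot <= a.
Proof. by apply/con_leP => x y ->; apply: con_refl. Qed.

Fact con_le_top a : a <= con_top.
Proof. by apply/con_leP. Qed.

HB.instance Definition _ :=
  Order.hasBottom.Build con_display con con_bot_le.
HB.instance Definition _ :=
  Order.hasTop.Build con_display con con_le_top.

Definition con_gen (R : A -> A -> Prop) : con :=
  con_inf [set b : con | forall x y, R x y -> b x y].

Definition compact_con (a : con) : Prop :=
  forall S : set con, a <= con_sup S ->
  exists s : seq con, (forall b, b \in s -> S b) /\ a <= \join_(b <- s) b.

End Congruence.

Arguments con {sg} A.

Section QuotientAlgebra.
Variables (sg : signature) (A : algebra sg) (t : con A).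

Definition con_bool : rel {classic A} := fun x y => `[< t x y >].

Fact con_bool_equiv : equiv_class_of con_bool.
Proof.
split=> [x|x y|y x z]; first exact/asboolP/con_refl.
  by apply/asboolP/asboolP => /con_sym.
by move=> /asboolP xy /asboolP yz; apply/asboolP; apply: con_trans xy yz.
Qed.

Canonical con_bool_equiv_rel := EquivRelPack con_bool_equiv.

Definition quo_carrier := {eq_quot con_bool}.
Definition quo_pi (x : A) : quo_carrier := \pi_quo_carrier x.
Definition quo_repr (u : quo_carrier) : A := repr u.

Lemma quo_reprK u : quo_pi (quo_repr u) = u.
Proof. exact: reprK. Qed.

Lemma quo_piP x y : quo_pi x = quo_pi y <-> t x y.
Proof.
split=> [/eqmodP /asboolP//|xy]; exact/eqmodP/asboolP.
Qed.

Lemma quo_inhabited : inhabited quo_carrier.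
Proof. by have [a] := carrier_inhabited A; constructor; exact: quo_pi a. Qed.

Definition quo_algebra : algebra sg :=
  Algebra (fun f u => quo_pi (op f (quo_repr \o u))) quo_inhabited.

Fact quo_pi_op f (x : 'I_(arity f) -> A) :
  (quo_pi (op f x) : quo_algebra) =
  op f ((quo_pi : A -> quo_algebra) \o x).
Proof.
by apply/quo_piP/con_op => i /=; apply/quo_piP; rewrite quo_reprK.
Qed.

Definition quo_hom : hom A quo_algebra :=
  Hom (hom_fun := quo_pi : A -> quo_algebra) quo_pi_op.

Lemma quo_hom_surj : surjective quo_hom.
Proof. by move=> u; exists (quo_repr u); apply: quo_reprK. Qed.

End QuotientAlgebra.

Section HomCongruence.
Variables (sg : signature) (A B : algebra sg) (h : hom A B).

Definition con_preim (b : con B) : con A.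
Proof.
exists (fun x y => b (h x) (h y)).
- by move=> x; apply: con_refl.
- by move=> x y; apply: con_sym.
- by move=> x y z; apply: con_trans.
- by move=> f x y xy; rewrite !hom_op; apply: con_op.
Defined.

Definition con_ker : con A := con_preim \bot.

Lemma con_ker_join (a : con A) x y : h x = h y -> (a `|` con_ker) x y.
Proof. by move=> hxy; have /con_leP := leUr con_ker a; apply. Qed.

(* The set-theoretic image of a congruence need not be a congruence: for      *)
(* surjective h, that of a `|` con_ker always is.                             *)
Definition con_im (hs : surjective h) (a : con A) : con B.
Proof.
exists (fun u v => exists x y, [/\ (a `|` con_ker) x y, h x = u & h y = v]).
- by move=> u; have [x <-] := hs u; exists x, x; split=> //; apply: con_refl.
- by move=> u v [x [y [xy xu yv]]]; exists y, x; split=> //; apply: con_sym.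
- move=> u v w [x [y [xy xu yv]]] [y' [z [yz yv' zw]]].
  exists x, z; split=> //; apply: con_trans xy (con_trans _ yz).
  by apply: con_ker_join; rewrite yv.
- move=> f u v /choice[x /choice[y xy]].
  exists (op f x), (op f y); split.
  + by apply: con_op => i; have [] := xy i.
  + by rewrite hom_op; congr op; apply/funext => i /=; have [] := xy i.
  + by rewrite hom_op; congr op; apply/funext => i /=; have [] := xy i.
Defined.

End HomCongruence.

Definition congruence_modular (sg : signature) (V : variety sg) : Prop :=
  forall A : algebra sg, V A -> forall a b c : con A,
    a <= c -> a `|` (b `&` c) = (a `|` b) `&` c.

Definition subuniverse (sg : signature) (A : algebra sg) (S : set A) : Prop :=
  forall (f : symb sg) (x : 'I_(arity f) -> A), (forall i, S (x i)) -> S (op f x).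

Definition semidegenerate (sg : signature) (V : variety sg) : Prop :=
  forall A : algebra sg, V A -> (exists x y : A, x <> y) ->
  forall a : A, ~ subuniverse [set a].

(* Values outside the variety under consideration are irrelevant.             *)
Definition con_operation (sg : signature) :=
  forall A : algebra sg, con A -> con A -> con A.

Definition commutator_axioms (sg : signature) (V : variety sg)
    (C : con_operation sg) : Prop :=
  forall (A B : algebra sg) (h : hom A B) (hs : surjective h), V A -> V B ->
  forall a b : con A,
    C A a b <= a `&` b /\
    C A a b `|` con_ker h = con_preim h (C B (con_im hs a) (con_im hs b)).

Definition is_commutator (sg : signature) (V : variety sg)
    (C : con_operation sg) : Prop :=
  commutator_axioms V C /\
  forall C' : con_operation sg, commutator_axioms V C' ->
  forall A : algebra sg, V A -> forall a b : con A, C' A a b <= C A a b.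

Section CommutatorNotions.
Variables (sg : signature) (C : con_operation sg) (A : algebra sg).

Definition compact_closed : Prop :=
  forall a b : con A, compact_con a -> compact_con b -> compact_con (C a b).

(* [a, b]^n; index 0 is only meaningful for a = b. *)
Fixpoint comm_iter (a b : con A) (n : nat) : con A :=
  match n with
  | 0 => a
  | 1 => C a b
  | m.+1 => C (comm_iter a b m) (comm_iter a b m)
  end.

Definition condition_star : Prop :=
  forall a b : con A, compact_con a -> compact_con b ->
  forall n : nat, (1 <= n)%N ->
  exists m : nat, C (comm_iter a a m) (comm_iter b b m) <= comm_iter a b n.

Definition prime_con (p : con A) : Prop :=
  p <> \top /\ forall a b : con A, C a b <= p -> a <= p \/ b <= p.

Definition con_radical (a : con A) : con A :=
  con_inf [set p | prime_con p /\ a <= p].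

Definition congruence_normal : Prop :=
  forall t n : con A, t `|` n = \top ->
  exists a b : con A, [/\ t `|` a = \top, n `|` b = \top & C a b = \bot].

End CommutatorNotions.

Definition normal_lattice (d : Order.disp_t) (L : tbDistrLatticeType d) : Prop :=
  forall a b : L, a `|` b = \top ->
  exists e f : L, [/\ a `|` e = \top, b `|` f = \top & e `&` f = \bot].

Section CompactFacts.
Variables (sg : signature) (A : algebra sg).
Implicit Types (a b : con A) (S : set (con A)).

Lemma compact_con_bot : compact_con (\bot : con A).
Proof. by move=> S _; exists [::]; split=> //; apply: le0x. Qed.

Lemma compact_con_join a b :
  compact_con a -> compact_con b -> compact_con (a `|` b).
Proof.
move=> ka kb S; rewrite leUx => /andP[/ka[s [sS as_]] /kb[u [uS bu]]].
exists (s ++ u); split=> [c|]; first by rewrite mem_cat => /orP[/sS|/uS].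
by rewrite big_cat; apply: leU2.
Qed.

Definition fin_sup_rel S (x y : A) : Prop :=
  exists s : seq (con A), (forall b, b \in s -> S b) /\ (\join_(b <- s) b) x y.

Lemma con_supE S x y : con_sup S x y -> fin_sup_rel S x y.
Proof.
have lerel a b u v : a <= b -> a u v -> b u v by move=> /con_leP; apply.
have join1 s b : b \in s -> b <= \join_(c <- s) c.
  by move=> bs; apply: (joins_sup_seq _ bs).
have [r rE] : exists r : con A, forall u v, r u v <-> fin_sup_rel S u v.
  unshelve eexists (Con (con_rel := fin_sup_rel S) _ _ _ _) => //.
  - by move=> u; exists [::]; split=> //; apply: con_refl.
  - by move=> u v [s [sS suv]]; exists s; split=> //; apply: con_sym.
  - move=> u v w [s [sS suv]] [t [tS tvw]]; exists (s ++ t); split.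
      by move=> b; rewrite mem_cat => /orP[/sS|/tS].
    rewrite big_cat; apply: con_trans (lerel _ _ _ _ _ suv) (lerel _ _ _ _ _ tvw).
      exact: leUl.
    exact: leUr.
  - move=> f u v /choice[s suv].
    exists (flatten [seq s i | i <- enum 'I_(arity f)]); split.
      by move=> b /flattenP[t /mapP[i _ ->]]; have [+ _] := suv i; apply.
    apply: con_op => i; have [_] := suv i; apply: lerel.
    apply/joinsP_seq => b bsi _; apply: join1.
    by apply/flattenP; exists (s i) => //; apply: map_f; rewrite mem_enum.
move=> Sxy; apply/rE; apply: Sxy => a Sa; apply/con_leP => u v auv; apply/rE.
exists [:: a]; split; first by move=> b; rewrite inE => /eqP->.
by rewrite big_seq1.
Qed.

Lemma compact_con_principal (u v : A) :
  compact_con (con_gen (fun x y => x = u /\ y = v)).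
Proof.
move=> S /con_leP/(_ u v) h.
have [s [sS suv]] : fin_sup_rel S u v.
  by apply/con_supE/h => a; apply.
by exists s; split=> //; apply/con_leP => x y; apply => _ _ [-> ->].
Qed.

Lemma compact_con_joins (I : eqType) (s : seq I) (F : I -> con A) :
  (forall i, compact_con (F i)) -> compact_con (\join_(i <- s) F i).
Proof.
move=> kF; elim: s => [|i s ih]; first by rewrite big_nil; apply: compact_con_bot.
by rewrite big_cons; apply: compact_con_join.
Qed.

Lemma compact_con_top (V : variety sg) :
  semidegenerate V -> V A -> compact_con (\top : con A).
Proof.
move=> sdV VA; have [a] := carrier_inhabited A.
pose F f := con_gen (fun x y : A => x = a /\ y = op f (fun=> a)).
pose t := \join_(f <- enum (symb sg)) F f.
have -> : \top = t; last first.
  by apply: compact_con_joins => f; apply: compact_con_principal.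
have ta f : t a (op f (fun=> a)).
  have /con_leP : F f <= t by apply: (joins_sup_seq (P := xpredT)); rewrite ?mem_enum.
  by apply=> b; apply.
have VQ : V (quo_algebra t) by apply: variety_image (@quo_hom_surj _ _ t) VA.
have sub : subuniverse [set quo_hom t a].
  move=> f x xa; have -> : x = quo_hom t \o (fun=> a) by apply/funext => i; apply: xa.
  by rewrite -hom_op /=; apply/quo_piP/con_sym.
apply/le_anti/andP; split; last exact: lex1.
apply/con_leP => x y _; apply/quo_piP; apply: contrapT => xy.
by apply: (sdV _ VQ _ _ sub); exists (quo_hom t x), (quo_hom t y).
Qed.

End CompactFacts.

Section CompactCongruences.
Variables (sg : signature) (A : algebra sg).

Record compact_sub := CompactCon {
  compact_val :> con A;
  compact_valP : compact_con compact_val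
}.

HB.instance Definition _ := gen_eqMixin compact_sub.
HB.instance Definition _ := gen_choiceMixin compact_sub.

Definition K_join (a b : compact_sub) : compact_sub :=
  CompactCon (compact_con_join (@compact_valP a) (@compact_valP b)).

Definition K_bot : compact_sub := CompactCon (@compact_con_bot sg A).

End CompactCongruences.

Arguments compact_sub {sg} A.
Arguments K_bot {sg} A.

Section ReticulationType.
Variables (sg : signature) (C : con_operation sg) (A : algebra sg).

Definition ret_eq : rel (compact_sub A) :=
  fun a b => con_radical C a == con_radical C b.

Fact ret_eq_equiv : equiv_class_of ret_eq.
Proof.
split=> [a|a b|b a c]; rewrite /ret_eq //.
by move=> /eqP-> /eqP->.
Qed.

Canonical ret_eq_equiv_rel := EquivRelPack ret_eq_equiv.

Lemma pi_ret_eqP (a b : compact_sub A) :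
  \pi_{eq_quot ret_eq} a = \pi_{eq_quot ret_eq} b <->
  con_radical C a = con_radical C b.
Proof. by split=> [/eqmodP/eqP|ab]; last exact/eqmodP/eqP. Qed.

(* The carrier depends on C and A only; the other arguments are what is       *)
(* needed for the lattice structure below.                                    *)
Definition reticulation (V : variety sg) of semidegenerate V &
  is_commutator V C & V A & compact_closed C A := {eq_quot ret_eq}.

End ReticulationType.

Section Reticulation.
Variables (sg : signature) (V : variety sg) (sdV : semidegenerate V).
Variables (C : con_operation sg) (CV : is_commutator V C).
Variables (A : algebra sg) (VA : V A) (kA : compact_closed C A).

Local Notation L := (reticulation sdV CV VA kA).
Local Notation K := (compact_sub A).

HB.instance Definition _ := Choice.copy L {eq_quot @ret_eq sg C A}.

Definition K_comm (a b : K) : K :=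
  CompactCon (kA (@compact_valP _ _ a) (@compact_valP _ _ b)).

Definition K_top : K := CompactCon (compact_con_top sdV VA).

Definition ret_lambda (a : K) : L := \pi_{eq_quot @ret_eq sg C A} a.
Definition ret_repr (u : L) : K := repr (u : {eq_quot @ret_eq sg C A}).

Lemma ret_reprK u : ret_lambda (ret_repr u) = u.
Proof. exact: reprK. Qed.

Definition ret_join (u v : L) : L :=
  ret_lambda (K_join (ret_repr u) (ret_repr v)).
Definition ret_meet (u v : L) : L :=
  ret_lambda (K_comm (ret_repr u) (ret_repr v)).
Definition ret_bot : L := ret_lambda (K_bot A).
Definition ret_top : L := ret_lambda K_top.

Lemma comm_le_meet (a b : con A) : C a b <= a `&` b.
Proof.
pose i := @Hom sg A A id (fun f x => erefl).
have si : surjective i by move=> x; exists x.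
by have [+ _] := CV => /(_ A A i si VA VA a b)[].
Qed.

Lemma ret_lambda_eqP (a b : K) :
  ret_lambda a = ret_lambda b <-> con_radical C a = con_radical C b.
Proof. exact: pi_ret_eqP. Qed.

Lemma ret_lambdaP (a b : K) : ret_lambda a = ret_lambda b <->
  forall p, prime_con C p -> ((a : con A) <= p) = ((b : con A) <= p).
Proof.
have radP (c : con A) p : prime_con C p -> (c <= p) = (con_radical C c <= p).
  move=> pp; apply/idP/idP => [cp|].
    by apply/con_leP => x y; apply; split.
  by apply: le_trans; apply/con_infP => q [].
split=> [/ret_lambda_eqP abE p pp|abE]; first by rewrite (radP a)// (radP b)// abE.
apply/ret_lambda_eqP; congr con_inf; apply/seteqP; split=> p [pp ap]; split=> //.
  by rewrite -abE.
by rewrite abE.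
Qed.

Lemma K_joinP (a b : K) (p : con A) :
  ((K_join a b : con A) <= p) = ((a : con A) <= p) && ((b : con A) <= p).
Proof. exact: leUx. Qed.

Lemma K_commP (a b : K) (p : con A) : prime_con C p ->
  ((K_comm a b : con A) <= p) = ((a : con A) <= p) || ((b : con A) <= p).
Proof.
move=> [_ pp]; apply/idP/orP => [/pp//|abp].
apply: le_trans (comm_le_meet _ _) _.
by case: abp; apply: le_trans; [apply: leIl | apply: leIr].
Qed.

Lemma repr_lambdaP (a : K) (p : con A) : prime_con C p ->
  ((ret_repr (ret_lambda a) : con A) <= p) = ((a : con A) <= p).
Proof. by move=> pp; move: p pp; apply/ret_lambdaP/ret_reprK. Qed.

Lemma ret_joinE (a b : K) :
  ret_join (ret_lambda a) (ret_lambda b) = ret_lambda (K_join a b).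
Proof. by apply/ret_lambdaP => p pp; rewrite !K_joinP !repr_lambdaP. Qed.

Lemma ret_meetE (a b : K) :
  ret_meet (ret_lambda a) (ret_lambda b) = ret_lambda (K_comm a b).
Proof. by apply/ret_lambdaP => p pp; rewrite !K_commP ?repr_lambdaP. Qed.

Lemma ret_ind (P : L -> Prop) :
  (forall a, P (ret_lambda a)) -> forall u, P u.
Proof. by move=> Pl u; rewrite -[u]ret_reprK; apply: Pl. Qed.

Fact ret_meetC : commutative ret_meet.
Proof.
elim/ret_ind=> a; elim/ret_ind=> b; rewrite !ret_meetE.
by apply/ret_lambdaP => p pp; rewrite !K_commP// orbC.
Qed.

Fact ret_joinC : commutative ret_join.
Proof.
elim/ret_ind=> a; elim/ret_ind=> b; rewrite !ret_joinE.
by apply/ret_lambdaP => p pp; rewrite !K_joinP andbC.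
Qed.

Fact ret_meetA : associative ret_meet.
Proof.
elim/ret_ind=> a; elim/ret_ind=> b; elim/ret_ind=> c; rewrite !ret_meetE.
by apply/ret_lambdaP => p pp; rewrite !K_commP// orbA.
Qed.

Fact ret_joinA : associative ret_join.
Proof.
elim/ret_ind=> a; elim/ret_ind=> b; elim/ret_ind=> c; rewrite !ret_joinE.
by apply/ret_lambdaP => p pp; rewrite !K_joinP andbA.
Qed.

Fact ret_joinKI v u : ret_meet u (ret_join u v) = u.
Proof.
elim/ret_ind: u => a; elim/ret_ind: v => b; rewrite ret_joinE ret_meetE.
by apply/ret_lambdaP => p pp; rewrite K_commP// K_joinP; do 2!case: (_ <= _).
Qed.

Fact ret_meetKU v u : ret_join u (ret_meet u v) = u.
Proof.
elim/ret_ind: u => a; elim/ret_ind: v => b; rewrite ret_meetE ret_joinE.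
by apply/ret_lambdaP => p pp; rewrite K_joinP K_commP//; do 2!case: (_ <= _).
Qed.

Fact ret_meetUl : left_distributive ret_meet ret_join.
Proof.
elim/ret_ind=> a; elim/ret_ind=> b; elim/ret_ind=> c.
rewrite ret_joinE !ret_meetE ret_joinE.
by apply/ret_lambdaP => p pp; rewrite !(K_commP, K_joinP)//; do 3!case: (_ <= _).
Qed.

Fact ret_meetxx : idempotent_op ret_meet.
Proof.
elim/ret_ind=> a; rewrite ret_meetE.
by apply/ret_lambdaP => p pp; rewrite K_commP// orbb.
Qed.

HB.instance Definition _ := Order.isMeetJoinDistrLattice.Build
  ret_display L (fun _ _ => erefl) (fun _ _ => erefl)
  ret_meetC ret_joinC ret_meetA ret_joinA ret_joinKI ret_meetKU ret_meetUl
  ret_meetxx.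

Fact ret_bot_le (u : L) : ret_bot <= u.
Proof.
elim/ret_ind: u => a; apply/eqP; rewrite [LHS]ret_meetE.
by apply/ret_lambdaP => p pp; rewrite K_commP// le0x.
Qed.

Fact ret_le_top (u : L) : u <= ret_top.
Proof.
elim/ret_ind: u => a; apply/eqP; rewrite [LHS]ret_meetE.
apply/ret_lambdaP => p pp; rewrite K_commP//= le1x.
by case: pp => /eqP/negPf-> _; rewrite orbF.
Qed.

HB.instance Definition _ :=
  Order.hasBottom.Build ret_display L ret_bot_le.
HB.instance Definition _ :=
  Order.hasTop.Build ret_display L ret_le_top.

End Reticulation.

(* Main.v *)
Require Import Defs.
From mathcomp Require Import all_boot all_order.
From mathcomp Require Import boolp classical_sets.

(** Why the theorem holds.  Two facts about the commutator do all the work: it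
    is monotone, and [\top, \top] = \top.  Neither is an axiom; both are read
    off the maximality of the commutator, by exhibiting other operations that
    satisfy the commutator axioms.

    Monotonicity ([comm_mono]): the operation sending (a, b) to the join of all
    C a' b' with a' <= a and b' <= b again satisfies the axioms, congruence
    modularity being what lifts a congruence below the image of a to one below
    a.  Hence it lies below C.

    [\top, \top] = \top ([comm_top]): the term-condition operation, which sends
    (a, b) to the least d such that a centralizes b modulo d, satisfies the
    axioms ([term_commutator_axioms]), hence lies below C.  If the equality
    failed, a nontrivial quotient B would have [\top, \top] = \bot, so \top would
    centralize itself modulo equality in B; then the diagonal is a class of a
    congruence of B * B and gives a one-element subalgebra of a nontrivial
    quotient of B * B, which semidegeneracy forbids.  That the term-condition
    operation satisfies the axioms rests on the shifting lemma, applied in the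
    algebra of pairs related by a congruence; its crux is the symmetry
    [centralizes_tr].

    Given these facts, a congruence that is maximal among those lying above no
    member of a family of compact congruences is prime, provided that any
    commutator of two members lies above a member ([prime_avoiding]).  The family
    {\top} shows that a proper congruence lies below a prime, so that lambda a = 1
    exactly when a = \top; the family of iterates of a compact a shows that a is
    nilpotent as soon as it lies below all primes.

    If A is congruence normal, the two congruences provided by normality can be
    shrunk to compact ones, by monotonicity of C, and their classes then witness
    normality of the reticulation.
    Conversely, witnesses e, f in the reticulation satisfy [e, f] below every
    prime, so some iterate [e, f]^n is \bot, and the condition on iterates yields
    m with [[e, e]^m, [f, f]^m] = \bot; passing from e to [e, e]^m preserves
    a v e = \top because a prime above [e, e]^m is above e. *)

Set Implicit Arguments.
Unset Strict Implicit.
Unset Printing Implicit Defensive.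

Import Order.TTheory.
Local Open Scope classical_set_scope.
Local Open Scope order_scope.

(** * Modularity and compatible relations *)

Section Preliminaries.
Variables (sg : signature).
Implicit Types (A B : algebra sg).

Lemma con_leE A (a b : con A) x y : a <= b -> a x y -> b x y.
Proof. by move=> /con_leP; apply. Qed.

Lemma con_joinl A (a b : con A) x y : a x y -> (a `|` b) x y.
Proof. exact/con_leE/leUl. Qed.

Lemma con_joinr A (a b : con A) x y : b x y -> (a `|` b) x y.
Proof. exact/con_leE/leUr. Qed.

Arguments con_joinl {A a} b {x y} _.
Arguments con_joinr {A} a {b x y} _.

Lemma con_meetI A (a b : con A) x y : a x y -> b x y -> (a `&` b) x y.
Proof. by move=> axy bxy; change (con_meet a b x y) => c [->|->]. Qed.

Arguments con_meetI {A a b x y} _ _.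

(** The only form in which modularity is used on elements: x and y are joined by
    the path x b u c v b y, whose middle step lies in a, so (x, y) belongs to
    ((a & c) v b) & a = (a & c) v (b & a), which is below c. *)
Lemma shifting (V : variety sg) A (a b c : con A) x y u v :
    congruence_modular V -> V A -> a `&` b <= c ->
    a x y -> a u v -> b x u -> b y v -> c u v -> c x y.
Proof.
move=> modV VA abc axy auv bxu byv cuv.
have sub : (a `&` c) `|` (b `&` a) <= c by rewrite leUx leIr meetC abc.
apply: con_leE sub _; rewrite (modV A VA); last exact: leIl.
apply: con_meetI (axy). apply: con_trans (con_joinr _ bxu) _.
apply: con_trans (con_joinr _ (con_sym byv)).
exact: con_joinl (con_meetI auv cuv).
Qed.

Section CompatibleRelation.
Variables (A : algebra sg) (R : A -> A -> Prop).
Hypothesis R_refl : forall x, R x x.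
Hypothesis R_sym : forall x y, R x y -> R y x.
Hypothesis R_op : forall (f : symb sg) (x y : 'I_(arity f) -> A),
  (forall i, R (x i) (y i)) -> R (op f x) (op f y).

(** The least congruence above a reflexive, symmetric, compatible relation is its
    transitive closure.  Recording the length of a chain lets the chains of
    several arguments be padded to a common length, so that operations can be
    applied to them link by link. *)
Fixpoint chain n x y :=
  if n is m.+1 then exists2 z, R x z & chain m z y else x = y.

Lemma chain_pad m n x y : (m <= n)%N -> chain m x y -> chain n x y.
Proof.
elim: m n x => [|m ih] [|n] x //= mn.
  by move=> <-; elim: n {mn} => [|n ihn] /=; exists x.
by case=> z xz zy; exists z => //; apply: ih.
Qed.

Lemma chain_cat m n x y z : chain m x y -> chain n y z -> chain (m + n) x z.
Proof.
elim: m x => [|m ih] x /=; first by move=> ->.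
by move=> [w xw wy] yz; exists w => //; apply: ih.
Qed.

Lemma chain_sym n x y : chain n x y -> chain n y x.
Proof.
elim: n x => [|n ih] x //= [z xz /ih zy].
have: chain (n + 1) y x by apply: chain_cat zy _; exists x => //; apply: R_sym.
by rewrite addn1.
Qed.

Lemma chain_op n f (x y : 'I_(arity f) -> A) :
  (forall i, chain n (x i) (y i)) -> chain n (op f x) (op f y).
Proof.
elim: n x => [|n ih] x /= xy; first by congr op; apply/funext.
have /choice[z xyz] : forall i, exists z, R (x i) z /\ chain n z (y i).
  by move=> i; have [z] := xy i; exists z.
by exists (op f z); [apply: R_op => i | apply: ih => i]; have [] := xyz i.
Qed.

Definition chain_con : con A.
Proof.
exists (fun x y => exists n, chain n x y).
- by move=> x; exists 0.
- by move=> x y [n /chain_sym]; exists n.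
- by move=> x y z [m xy] [n yz]; exists (m + n); apply: chain_cat xy yz.
- move=> f x y /choice[n xy]; exists (\max_i n i); apply: chain_op => i.
  exact: chain_pad (leq_bigmax i) (xy i).
Defined.

Lemma chain_con1 x y : R x y -> chain_con x y.
Proof. by exists 1; exists y. Qed.

Lemma chain_con_closed (P : A -> Prop) x y :
  (forall x y, R x y -> P x -> P y) -> chain_con x y -> P x -> P y.
Proof.
move=> RP [n]; elim: n x => [|n ih] x /=; first by move=> ->.
by move=> [z /RP xz /ih zy] /xz.
Qed.

End CompatibleRelation.
End Preliminaries.

(** * The algebra of pairs related by a congruence *)

Section PairAlgebra.
Variables (sg : signature) (A : algebra sg) (a : con A).

Definition pair_carrier := {p : A * A | a p.1 p.2}.

Lemma pair_op_subproof f (x : 'I_(arity f) -> pair_carrier) :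
  a (op f (fun i => (sval (x i)).1)) (op f (fun i => (sval (x i)).2)).
Proof. by apply: con_op => i; exact: svalP (x i). Qed.

Definition mkpair x y (axy : a x y) : pair_carrier := exist _ (x, y) axy.

Lemma pair_inhabited : inhabited pair_carrier.
Proof.
by have [x] := carrier_inhabited A; constructor; exact: mkpair (con_refl a x).
Qed.

Definition pair_algebra : algebra sg :=
  Algebra (fun f x => mkpair (pair_op_subproof x)) pair_inhabited.

Lemma pair_eq (p q : pair_algebra) :
  (sval p).1 = (sval q).1 -> (sval p).2 = (sval q).2 -> p = q.
Proof.
case: p q => [[x y] /= xy] [[u v] /= uv] xu yv.
by case: _ / xu uv => uv; case: _ / yv uv => uv; congr exist; apply: Prop_irrelevance.
Qed.

Definition pair_fst : hom pair_algebra A :=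
  @Hom _ pair_algebra A (fun p => (sval p).1) (fun f x => erefl).

Definition pair_snd : hom pair_algebra A :=
  @Hom _ pair_algebra A (fun p => (sval p).2) (fun f x => erefl).

Lemma pair_diag_op f (x : 'I_(arity f) -> A) :
  mkpair (con_refl a (op f x)) =
  op f ((fun y => mkpair (con_refl a y) : pair_algebra) \o x).
Proof. exact: pair_eq. Qed.

Definition pair_diag : hom A pair_algebra :=
  Hom (hom_fun := fun y => mkpair (con_refl a y) : pair_algebra) pair_diag_op.

Lemma variety_pair (V : variety sg) : V A -> V pair_algebra.
Proof.
move=> VA; pose g (p : pair_algebra) (b : bool) : A :=
  if b then (sval p).1 else (sval p).2.
have g_op f (x : 'I_(arity f) -> pair_algebra) :
    (g (op f x) : prod_algebra (fun=> A)) =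
    op f ((g : _ -> prod_algebra (fun=> A)) \o x).
  by apply/funext => -[].
apply: (variety_sub (h := Hom g_op)) (variety_prod _) => // p q pq.
by apply: pair_eq; [have := congr1 (@^~ true) pq | have := congr1 (@^~ false) pq].
Qed.

End PairAlgebra.

(** * The term condition *)

Section Matrices.
Variables (sg : signature).
Implicit Types (A B : algebra sg).

(** [matrices a b x y u v] stands for the 2 x 2 matrix with rows (x, y) and (u, v),
    obtained by applying a term to matrices with equal rows, related by a, and to
    matrices with equal columns, related by b. *)
Inductive matrices A (a b : con A) : A -> A -> A -> A -> Prop :=
| matrices_row x y : a x y -> matrices a b x y x y
| matrices_col x u : b x u -> matrices a b x x u u
| matrices_op f (x y u v : 'I_(arity f) -> A) :
    (forall i, matrices a b (x i) (y i) (u i) (v i)) ->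
    matrices a b (op f x) (op f y) (op f u) (op f v).

Lemma matrices_tr A (a b : con A) x y u v :
  matrices a b x y u v -> matrices b a x u y v.
Proof.
elim=> {x y u v} [x y|x u|f x y u v _ ih]; last exact: matrices_op.
  exact: matrices_col.
exact: matrices_row.
Qed.

Lemma matrices_swap A (a b : con A) x y u v :
  matrices a b x y u v -> matrices a b u v x y.
Proof.
elim=> {x y u v} [x y axy|x u /con_sym bux|f x y u v _ ih].
- exact: matrices_row.
- exact: matrices_col.
- exact: matrices_op.
Qed.

Lemma matrices_rowl A (a b : con A) x y u v : matrices a b x y u v -> a x y.
Proof.
elim=> {x y u v} [//|x u _|f x y u v _ ih]; first exact: con_refl.
exact: con_op.
Qed.

Lemma matrices_le A (a a' b b' : con A) x y u v : a <= a' -> b <= b' ->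
  matrices a b x y u v -> matrices a' b' x y u v.
Proof.
move=> aa bb; elim=> {x y u v} [x y|x u|f x y u v _ ih]; last exact: matrices_op.
  by move/(con_leE aa); apply: matrices_row.
by move/(con_leE bb); apply: matrices_col.
Qed.

(** The term condition: values of a term that coincide modulo d still do so after
    some of its other arguments are moved along b. *)
Definition centralizes A (a b d : con A) :=
  forall x y u v, matrices a b x y u v -> d x y -> d u v.

(** Turns the term condition into a congruence t of the algebra of pairs, to which
    the shifting lemma applies: t identifies the rows of matrices as well as pairs
    that agree modulo d, and still never relates a pair in d to a pair outside d.
    It is the transitive closure of: move by d, replace a row, move by d. *)
Lemma centralizes_con A (a b d : con A) : centralizes a b d ->
  exists t : con (pair_algebra a),
  [/\ forall p q : pair_algebra a,
        matrices a b (sval p).1 (sval p).2 (sval q).1 (sval q).2 -> t p q,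
      forall p q : pair_algebra a,
        d (sval p).1 (sval q).1 -> d (sval p).2 (sval q).2 -> t p q
    & forall p q : pair_algebra a,
        t p q -> d (sval p).1 (sval p).2 -> d (sval q).1 (sval q).2].
Proof.
move=> dab; pose close (p q : pair_algebra a) :=
  d (sval p).1 (sval q).1 /\ d (sval p).2 (sval q).2.
pose R (p q : pair_algebra a) := exists p' q', [/\ close p p', close q q'
  & matrices a b (sval p').1 (sval p').2 (sval q').1 (sval q').2].
have close_refl p : close p p by split; apply: con_refl.
have R_refl p : R p p.
  by exists p, p; split=> //; apply: matrices_row; exact: svalP p.
have R_sym p q : R p q -> R q p.
  by move=> [p' [q' [pp qq /matrices_swap pq]]]; exists q', p'.
have R_op f (x y : 'I_(arity f) -> pair_algebra a) :
    (forall i, R (x i) (y i)) -> R (op f x) (op f y).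
  move=> /choice[x' /choice[y' xy]]; exists (op f x'), (op f y'); split.
  - by split; apply: con_op => i; have [[]] := xy i.
  - by split; apply: con_op => i; have [_ []] := xy i.
  - by apply: matrices_op => i; have [] := xy i.
exists (chain_con R_refl R_sym R_op); split=> [p q pq|p q pq1 pq2|p q].
- by apply: chain_con1; exists p, q.
- apply: chain_con1; exists q, q; split=> //; apply: matrices_row; exact: svalP q.
- move=> pq; pose P (r : pair_algebra a) := d (sval r).1 (sval r).2.
  apply: (chain_con_closed (P := P) _ pq) => {pq}p {}q.
  move=> [p' [q' [[pp1 pp2] [qq1 qq2] /dab pq]]] dp.
  apply: con_trans qq1 (con_trans _ (con_sym qq2)); apply: pq.
  exact: con_trans (con_sym pp1) (con_trans dp pp2).
Qed.


Variable V : variety sg.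
Hypothesis modV : congruence_modular V.

(** Symmetry of the term condition, strengthened by the passage from d to d'.  Two
    shifts are needed in the algebra of pairs.  The first, with the kernels of the
    two projections, moves t-related pairs (c, r), (c, s) to (r, r), (r, s), whence
    d r s.  The second moves the first column of the matrix, placed on the diagonal
    as (x, x), (u, u), to its rows (x, y), (u, v). *)
Lemma centralizes_tr A (a b d d' : con A) : V A ->
  centralizes a b d -> d <= d' -> centralizes b a d'.
Proof.
move=> VA /centralizes_con[t [tM _ td]] dd' x u y v /matrices_tr Mxyuv d'xu.
have VP := variety_pair a VA; have sh := shifting modV VP.
have axy := matrices_rowl Mxyuv.
have auv := matrices_rowl (matrices_swap Mxyuv).
have bxu := matrices_rowl (matrices_tr Mxyuv).
have vert : t `&` con_ker (pair_fst a) <= con_preim (pair_snd a) d'.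
  apply/con_leP => p q pq; apply: con_leE dd' _.
  have tpq := con_leE (leIl _ _) pq.
  have {pq} /= pq : con_ker (pair_fst a) p q := con_leE (leIr _ _) pq.
  have apq : a (sval p).2 (sval q).2.
    apply: con_trans (con_sym (svalP p)) _; rewrite [(sval p).1]pq; exact: svalP q.
  apply: (td (pair_diag a (sval p).2) (mkpair apq)); last exact: con_refl.
  (* Changing the first entry does not alter the second one, so the pairs p, q
     are tied to the diagonal ones by the kernel of the second projection. *)
  apply: (sh (con_ker (pair_fst a)) (con_ker (pair_snd a)) t _ _ p q) => //.
  apply/con_leP => r s rs; rewrite (_ : r = s); first exact: con_refl.
  by apply: pair_eq; [exact: con_leE (leIl _ _) rs | exact: con_leE (leIr _ _) rs].
apply: (sh t (con_ker (pair_fst a)) (con_preim (pair_snd a) d')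
  (mkpair axy) (mkpair auv) (pair_diag a x) (pair_diag a u)) => //.
- exact: tM.
- by apply: tM => /=; apply: matrices_col.
Qed.

(** Monotonicity in d comes for free from applying the symmetry twice. *)
Lemma centralizes_le A (a b d d' : con A) : V A ->
  centralizes a b d -> d <= d' -> centralizes a b d'.
Proof. by move=> VA dab /(centralizes_tr VA dab) /(centralizes_tr VA); apply. Qed.

(** The congruence t of [centralizes_con] already identifies pairs that agree
    modulo d, so the diagonal map sends all of b v d into t. *)
Lemma centralizes_joinr A (a b d : con A) :
  centralizes a b d -> centralizes a (b `|` d) d.
Proof.
move=> /centralizes_con[t [tM tD td]].
have diag x u : (b `|` d) x u -> t (pair_diag a x) (pair_diag a u).
  apply: (con_leE (b := con_preim (pair_diag a) t)); rewrite leUx.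
  apply/andP; split; apply/con_leP => {}x {}u xu; last exact: tD.
  by apply: tM => /=; apply: matrices_col.
have tMd x y u v : matrices a (b `|` d) x y u v ->
    forall (axy : a x y) (auv : a u v), t (mkpair axy) (mkpair auv).
  elim=> {x y u v} [x y _|x u xu|f x y u v M ih] axy auv.
  - by rewrite (pair_eq (p := mkpair axy) (q := mkpair auv)) //; apply: con_refl.
  - rewrite (pair_eq (p := mkpair axy) (q := pair_diag a x)) //.
    rewrite (pair_eq (p := mkpair auv) (q := pair_diag a u)) //; exact: diag.
  - have axyi i := matrices_rowl (M i).
    have auvi i := matrices_rowl (matrices_swap (M i)).
    pose X i : pair_algebra a := mkpair (axyi i).
    pose U i : pair_algebra a := mkpair (auvi i).
    rewrite (pair_eq (p := mkpair axy) (q := op f X)) //.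
    rewrite (pair_eq (p := mkpair auv) (q := op f U)) //.
    by apply: con_op => i; apply: ih.
move=> x y u v M dxy.
have := td _ _ (tMd _ _ _ _ M (matrices_rowl M) (matrices_rowl (matrices_swap M))).
exact.
Qed.

Lemma centralizes_join A (a b d : con A) : V A ->
  centralizes a b d -> centralizes (a `|` d) (b `|` d) d.
Proof.
move=> VA /centralizes_joinr /(centralizes_tr VA)/(_ (lexx d)) /centralizes_joinr.
by move=> /(centralizes_tr VA)/(_ (lexx d)).
Qed.

(** One shift in A itself: rows lie in a, columns in b. *)
Lemma centralizes_meet A (a b : con A) : V A -> centralizes a b (a `&` b).
Proof.
move=> VA x y u v M abxy.
apply: (shifting modV VA (a := a) (b := b)
          (x := u) (y := v) (u := x) (v := y)) => //.
- exact: matrices_rowl (matrices_swap M).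
- exact: matrices_rowl M.
- exact: matrices_rowl (matrices_tr (matrices_swap M)).
- exact: con_sym (matrices_rowl (matrices_swap (matrices_tr M))).
Qed.

Section Transfer.
Variables (A B : algebra sg) (h : hom A B) (hs : surjective h).
Implicit Types (a b d : con A) (c : con B).

Lemma con_imP a x y : con_ker h <= a -> con_im hs a (h x) (h y) <-> a x y.
Proof.
move=> ka; split=> [[x' [y' [xy hx hy]]]|axy]; last first.
  by exists x, y; split=> //; apply: con_joinl.
have kaxy : forall z z', h z = h z' -> a z z'.
  by move=> z z' zz; apply: con_leE ka _.
apply: con_trans (kaxy _ _ (esym hx)) (con_trans _ (kaxy _ _ hy)).
by move: xy; rewrite (join_l ka).
Qed.

Lemma con_im_preim c : con_im hs (con_preim h c) = c.
Proof.
apply: conP => u v; have [x <-] := hs u; have [y <-] := hs v.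
apply: con_imP; apply/con_leP => z z' /= zz; rewrite [h z]zz; exact: con_refl.
Qed.

Lemma ker_le_preim c : con_ker h <= con_preim h c.
Proof. by apply/con_leP => z z' /= zz; rewrite [h z]zz; exact: con_refl. Qed.

Lemma con_preim_im a : con_preim h (con_im hs a) = a `|` con_ker h.
Proof.
apply: conP => x y; split.
  move=> [x' [y' [xy hx hy]]].
  have kxy z z' : h z = h z' -> (a `|` con_ker h) z z' by apply: con_ker_join.
  exact: con_trans (kxy _ _ (esym hx)) (con_trans xy (kxy _ _ hy)).
by move=> xy; exists x, y.
Qed.

Lemma matrices_image a b x y u v : matrices a b x y u v ->
  matrices (con_im hs a) (con_im hs b) (h x) (h y) (h u) (h v).
Proof.
elim=> {x y u v} [x y xy|x u xu|f x y u v _ ih].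
- by apply: matrices_row; exists x, y; split=> //; apply: con_joinl.
- by apply: matrices_col; exists x, u; split=> //; apply: con_joinl.
- by rewrite !hom_op; apply: matrices_op.
Qed.

(** Generating matrices of the image lift by definition of the image congruence, at
    the price of enlarging a and b by the kernel. *)
Lemma matrices_lift a b x y u v :
  matrices (con_im hs a) (con_im hs b) x y u v ->
  exists x' y' u' v', [/\ h x' = x, h y' = y, h u' = u, h v' = v &
    matrices (a `|` con_ker h) (b `|` con_ker h) x' y' u' v'].
Proof.
elim=> {x y u v} [x y [x' [y' [xy <- <-]]]|x u [x' [u' [xu <- <-]]]|f x y u v _].
- by exists x', y', x', y'; split=> //; apply: matrices_row.
- by exists x', x', u', u'; split=> //; apply: matrices_col.
- move=> /choice[x' /choice[y' /choice[u' /choice[v' M]]]].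
  exists (op f x'), (op f y'), (op f u'), (op f v').
  rewrite !hom_op; split; first [congr op; apply/funext|apply: matrices_op] => i;
  by case: (M i).
Qed.

Lemma centralizes_preim a b c : centralizes (con_im hs a) (con_im hs b) c ->
  centralizes a b (con_preim h c).
Proof. by move=> cab x y u v /matrices_image /cab. Qed.

Lemma centralizes_im a b d : V A -> con_ker h <= d -> centralizes a b d ->
  centralizes (con_im hs a) (con_im hs b) (con_im hs d).
Proof.
move=> VA kd /(centralizes_join VA) dab x y u v.
move=> /matrices_lift[x' [y' [u' [v' [<- <- <- <- M]]]]].
rewrite !con_imP//; apply: dab; apply: matrices_le M; exact: leU2.
Qed.

End Transfer.

Definition term_commutator : con_operation sg :=
  fun A a b => con_inf [set d | centralizes a b d].

Lemma term_commutator_le A (a b d : con A) :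
  centralizes a b d -> term_commutator a b <= d.
Proof. by move=> dab; apply/con_leP => x y; apply. Qed.

Lemma centralizes_term_commutator A (a b : con A) :
  centralizes a b (term_commutator a b).
Proof. by move=> x y u v M xy d dab; apply: dab (M) (xy d dab). Qed.

(** Since centralization passes back and forth between A and its image B, for
    moduli above the kernel, the homomorphism axiom reduces to the fact that the
    join of the kernel and the least modulus for A is again a modulus for A. *)
Lemma term_commutator_axioms : commutator_axioms V term_commutator.
Proof.
move=> A B h hs VA VB a b; split.
  exact/term_commutator_le/centralizes_meet.
apply/le_anti/andP; split.
  rewrite leUx ker_le_preim andbT; apply/term_commutator_le.
  exact/centralizes_preim/centralizes_term_commutator.
have sub : term_commutator (con_im hs a) (con_im hs b) <=
    con_im hs (term_commutator a b).
  apply: term_commutator_le.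
  rewrite -[con_im hs (term_commutator a b)](con_im_preim hs) con_preim_im.
  apply: centralizes_im => //; first exact: leUr.
  exact: centralizes_le VA (@centralizes_term_commutator _ a b) (leUl _ _).
by rewrite -(con_preim_im hs); apply/con_leP => x y /(con_leE sub).
Qed.

End Matrices.

(** * Consequences of the maximality of the commutator *)

Section CommutatorTheory.
Variables (sg : signature) (V : variety sg).
Hypotheses (modV : congruence_modular V) (sdV : semidegenerate V).
Variables (C : con_operation sg) (CV : is_commutator V C).
Implicit Types (A B : algebra sg).

Lemma con_sup_ub A (S : set (con A)) a : S a -> a <= con_sup S.
Proof. by move=> Sa; apply/con_infP => b; apply. Qed.

Lemma preim_le_im A B (h : hom A B) (hs : surjective h) d c :
  con_ker h <= d -> (con_preim h c <= d) = (c <= con_im hs d).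
Proof.
move=> kd; apply/con_leP/con_leP => cd x y.
  by have [x' <-] := hs x; have [y' <-] := hs y => /cd; apply: (con_imP _ _ _ kd).2.
by move=> /cd /(con_imP hs _ _ kd).
Qed.

Lemma con_im_ker A B (h : hom A B) (hs : surjective h) a :
  con_im hs (a `|` con_ker h) = con_im hs a.
Proof. by rewrite -(con_preim_im hs) con_im_preim. Qed.

Lemma con_preim_le A B (h : hom A B) c d :
  c <= d -> con_preim h c <= con_preim h d.
Proof. by move=> cd; apply/con_leP => x y; apply: con_leE cd. Qed.

Lemma con_im_le A B (h : hom A B) (hs : surjective h) a b :
  a <= b -> con_im hs a <= con_im hs b.
Proof.
move=> ab; apply/con_leP => u v [x [y [xy xu yv]]]; exists x, y; split=> //.
by apply: con_leE xy; apply: leU2.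
Qed.

Lemma comm_axioms : commutator_axioms V C.
Proof. by case: CV. Qed.

Lemma comm_le A (a b : con A) : V A -> C a b <= a `&` b.
Proof. by move=> VA; apply: comm_le_meet CV _ VA _ _. Qed.

(** A congruence c below the image of a is the image of a congruence below a: by
    modularity, joining a & h^-1 c with the kernel gives (a v ker h) & h^-1 c. *)
Lemma con_im_meet_preim A B (h : hom A B) (hs : surjective h) a c :
  V A -> c <= con_im hs a -> con_im hs (a `&` con_preim h c) = c.
Proof.
move=> VA ca; rewrite -(con_im_ker hs) joinC modV//; last exact: ker_le_preim.
rewrite joinC -(con_preim_im hs) meet_r ?con_im_preim//.
exact: con_preim_le.
Qed.

(** The monotone hull of C satisfies the commutator axioms, so it is below C. *)
Lemma comm_mono A (a a' b b' : con A) : V A -> a <= a' -> b <= b' ->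
  C a b <= C a' b'.
Proof.
move=> VA aa bb; pose D A (a b : con A) :=
  con_sup [set c | exists a' b', [/\ a' <= a, b' <= b & c = C a' b']].
suff Dax : commutator_axioms V D.
  have [_ max] := CV; apply: le_trans (max _ Dax A VA a' b').
  by apply: con_sup_ub; exists a, b.
move=> {aa bb a a' b b' VA}A B h hs VA VB a b.
have Dub (E : algebra sg) (c d c' d' : con E) :
    c' <= c -> d' <= d -> C c' d' <= D E c d.
  by move=> cc dd; apply: con_sup_ub; exists c', d'.
split; first apply/con_supP => _ [a' [b' [aa bb ->]]].
  by apply: le_trans (comm_le _ _ VA) _; apply: leI2.
apply/le_anti/andP; split.
  rewrite leUx ker_le_preim andbT; apply/con_supP => _ [a' [b' [aa bb ->]]].
  have [_ homC] := comm_axioms hs VA VB a' b'.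
  apply: le_trans (leUl _ (con_ker h)) _; rewrite homC.
  by apply/con_preim_le/Dub; apply: con_im_le.
rewrite (preim_le_im hs); last exact: leUr.
apply/con_supP => _ [c [d [ca db ->]]].
have [_] := comm_axioms hs VA VB (a `&` con_preim h c) (b `&` con_preim h d).
rewrite !con_im_meet_preim// => homC.
rewrite -(preim_le_im hs) -?homC; last exact: leUr.
by apply: leU2 => //; apply: Dub; apply: leIl.
Qed.

Lemma con_ker_quo A (p : con A) : con_ker (quo_hom p) = p.
Proof. by apply: conP => x y; apply: quo_piP. Qed.

Lemma con_im_top A B (h : hom A B) (hs : surjective h) : con_im hs \top = \top.
Proof.
apply/le_anti/andP; split; first exact: lex1.
by rewrite -(preim_le_im hs) ?lex1.
Qed.

(** If the whole algebra is abelian, the diagonal is a class of a congruence t of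
    A * A, that is, a one-element subalgebra of the quotient by t; this quotient
    separates (x, x) from (x, y) whenever x and y differ. *)
Lemma abelian_trivial A : V A -> centralizes \top \top (\bot : con A) ->
  forall x y : A, x = y.
Proof.
move=> VA /centralizes_con[t [tM _ td]] x y; apply: contrapT => xy.
have xy1 : (\top : con A) x y by [].
have VQ := variety_image (quo_hom_surj (t := t)) (variety_pair _ VA).
pose dx : pair_algebra \top := pair_diag \top x.
apply: (sdV VQ _ (a := quo_hom t dx)).
  exists (quo_hom t dx), (quo_hom t (mkpair xy1)).
  by move=> /quo_piP /td; apply: contra_not xy; apply.
move=> f g gx; have -> : g = quo_hom t \o (fun=> dx).
  by apply/funext => i; apply: gx.
rewrite -hom_op; apply/quo_piP; apply: tM => /=; exact: matrices_col.
Qed.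

(** In the quotient by p = [\top, \top] the commutator of \top with itself is \bot,
    and the term-condition operation lies below the commutator, so the quotient is
    abelian, hence trivial. *)
Lemma comm_top A : V A -> C (\top : con A) \top = \top.
Proof.
move=> VA; set p := C _ _; pose h := quo_hom p.
have hs := @quo_hom_surj _ _ p; have VB := variety_image hs VA.
have [_] := comm_axioms hs VA VB \top \top.
rewrite con_im_top con_ker_quo joinxx => pE.
have sub : C (\top : con (quo_algebra p)) \top <= \bot.
  rewrite -(con_im_preim hs \bot) -(preim_le_im hs) ?lexx //.
  by rewrite -pE; apply/con_leP => x y /quo_piP.
have cent : centralizes \top \top (\bot : con (quo_algebra p)).
  move=> x y u v M xy.
  have [_ max] := CV.
  apply: con_leE (le_trans (max _ (term_commutator_axioms modV) _ VB _ _) sub) _.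
  apply: centralizes_term_commutator M _.
  by rewrite [x]xy; apply: con_refl.
apply/le_anti/andP; split; first exact: lex1.
apply/con_leP => x y _; apply/quo_piP; exact: (abelian_trivial VB cent).
Qed.

(** Joining a and b with p does not change their images modulo p. *)
Lemma comm_join_le A (a b p : con A) : V A ->
  C (a `|` p) (b `|` p) <= C a b `|` p.
Proof.
move=> VA; have hs := @quo_hom_surj _ _ p; have VB := variety_image hs VA.
have [_ abE] := comm_axioms hs VA VB a b.
have [_ apE] := comm_axioms hs VA VB (a `|` p) (b `|` p).
have imE c : con_im hs (c `|` p) = con_im hs c.
  by rewrite -(con_im_ker hs c) con_ker_quo.
move: abE apE; rewrite !con_ker_quo !imE => -> <-; exact: leUl.
Qed.

(** * Prime congruences *)

Lemma total_finite_join A (S : set (con A)) (s : seq (con A)) c :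
  total_on S (fun a b => a <= b) -> S c -> (forall b, b \in s -> S b) ->
  exists2 m, S m & \join_(b <- s) b <= m.
Proof.
move=> Stot Sc; elim: s => [|b s ih] sS; first by exists c; rewrite ?big_nil ?le0x.
have [|m Sm sm] := ih; first by move=> d ds; apply: sS; rewrite inE ds orbT.
have Sb : S b by apply: sS; rewrite inE eqxx.
rewrite big_cons; have [bm|mb] := Stot _ _ Sb Sm.
  by exists m; rewrite ?leUx ?bm.
by exists b; rewrite // leUx lexx (le_trans sm).
Qed.

(** The congruence analogue of Krull's separation lemma.  Compactness of the
    members of K makes Zorn's lemma apply.  If p is maximal and neither a nor b is
    below p, then a v p and b v p lie above some k, l in K, and
    [k, l] <= [a v p, b v p] <= [a, b] v p, so [a, b] is not below p. *)
Lemma prime_avoiding A (K : set (con A)) (q : con A) : V A ->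
  (exists k, K k) -> (forall k, K k -> compact_con k) ->
  (forall k l, K k -> K l -> exists2 m, K m & m <= C k l) ->
  (forall k, K k -> ~~ (k <= q)) ->
  exists p, [/\ prime_con C p, q <= p & forall k, K k -> ~~ (k <= p)].
Proof.
move=> VA [k0 Kk0] Kc Km Kq.
pose good p := q <= p /\ forall k, K k -> ~~ (k <= p).
have [|||S Stot|[p [qp Kp]] pmax] :=
    @Zorn {p | good p} (fun a b => sval a <= sval b).
- by move=> a /=; apply: lexx.
- by move=> b a c /=; apply: le_trans.
- move=> [a ga] [b gb] /= ab ba; have abE : a = b by apply/le_anti; rewrite ab ba.
  by case: _ / abE gb {ab ba} => gb; congr exist; apply: Prop_irrelevance.
- (* q is added so that the empty chain also has an upper bound above q. *)
  pose T := q |` [set sval a | a in S].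
  have gq : good q by split.
  have Tgood a : T a -> good a by case=> [->//|[[b gb] _ <-]].
  have Ttot : total_on T (fun a b => a <= b).
    move=> a b Ta Tb; case: (Ta) => [->|[a' Sa <-]].
      by left; have [] := Tgood _ Tb.
    case: (Tb) => [->|[b' Sb <-]]; last exact: Stot.
    by right; case: (a') => ? [].
  have gT : good (con_sup T).
    split=> [|k Kk]; first by apply: con_sup_ub; left.
    apply/negP => kT; have [s [sT ks]] := Kc k Kk _ kT.
    have [m Tm sm] := total_finite_join Ttot (or_introl erefl : T q) sT.
    by have [_ /(_ k Kk)/negP] := Tgood m Tm; apply; apply: le_trans ks sm.
  exists (exist _ _ gT) => a Sa /=; apply: con_sup_ub; right; by exists a.
have above a : ~~ (a <= p) -> exists2 k, K k & k <= a `|` p.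
  move=> ap; apply: contrapT => noK; move/negP: ap; apply.
  have gap : good (a `|` p).
    split=> [|k Kk]; first exact: le_trans qp (leUr _ _).
    by apply/negP => kap; apply: noK; exists k.
  have /(congr1 sval)/= <- := pmax (exist _ _ gap) (leUr _ _).
  exact: leUl.
exists p; split=> //; split=> [pT|a b abp].
  by have /negP := Kp _ Kk0; apply; rewrite pT lex1.
apply: contrapT => /not_orP[/negP/above[k Kk kap] /negP/above[l Kl lbp]].
have [m Kmm mkl] := Km k l Kk Kl; have /negP := Kp m Kmm; apply.
apply: le_trans mkl (le_trans (comm_mono VA kap lbp) _).
by apply: le_trans (comm_join_le _ _ _ VA) _; rewrite leUx abp lexx.
Qed.

(** [\top, \top] = \top makes the singleton {\top} an admissible family. *)
Lemma prime_above A (a : con A) : V A -> a <> \top ->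
  exists2 p, prime_con C p & a <= p.
Proof.
move=> VA aT; have [|||| p [pp ap _]] := @prime_avoiding A [set \top] a VA.
- by exists \top.
- by move=> _ ->; apply: compact_con_top sdV VA.
- by move=> _ _ -> ->; exists \top => //; rewrite comm_top.
- move=> _ ->; apply/negP => Ta; apply: aT; apply/le_anti; rewrite Ta lex1//.
- by exists p.
Qed.

Lemma comm_iterS A (a : con A) n :
  comm_iter C a a n.+1 = C (comm_iter C a a n) (comm_iter C a a n).
Proof. by case: n. Qed.

Lemma comm_iter_anti A (a : con A) m n : V A -> (m <= n)%N ->
  comm_iter C a a n <= comm_iter C a a m.
Proof.
move=> VA; elim: n => [|n ih]; first by rewrite leqn0 => /eqP->.
rewrite leq_eqVlt => /predU1P[->//|/ih]; apply: le_trans.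
by rewrite comm_iterS; apply: le_trans (comm_le _ _ VA) (leIl _ _).
Qed.

Lemma compact_comm_iter A (a : con A) n : compact_closed C A ->
  compact_con a -> compact_con (comm_iter C a a n).
Proof. by move=> kA ka; elim: n => // n ih; rewrite comm_iterS; apply: kA. Qed.

(** A prime avoiding every iterate of a would in particular avoid the iterate of
    index 0, which is a. *)
Lemma radical_nilpotent A (a : con A) : V A -> compact_closed C A ->
  compact_con a -> (forall p, prime_con C p -> a <= p) ->
  exists n, comm_iter C a a n = \bot.
Proof.
move=> VA kA ka aP; apply: contrapT => nz.
have [||||p [pp _ /(_ a)]] :=
  @prime_avoiding A [set comm_iter C a a n | n in setT] \bot VA.
- by exists a, 0.
- by move=> _ [n _ <-]; apply: compact_comm_iter.
- move=> _ _ [m _ <-] [n _ <-].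
  exists (comm_iter C a a (maxn m n).+1); first by exists (maxn m n).+1.
  rewrite comm_iterS; apply: comm_mono => //; apply: comm_iter_anti => //.
    exact: leq_maxl.
  exact: leq_maxr.
- move=> _ [n _ <-]; rewrite lex0; apply/eqP => nE; apply: nz; by exists n.
- by move=> /(_ (ex_intro2 _ _ 0 I erefl))/negP; apply; apply: aP.
Qed.

Lemma comm_iter_shift A (a b : con A) n :
  comm_iter C a b n.+1 = comm_iter C (C a b) (C a b) n.
Proof. by elim: n => // n ih; rewrite comm_iterS -ih. Qed.

(** A prime congruence above the n-th iterate of b is above b. *)
Lemma join_comm_iter_top A (a b : con A) n : V A ->
  a `|` b = \top -> a `|` comm_iter C b b n = \top.
Proof.
move=> VA abT; apply: contrapT => /(prime_above VA)[p pp].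
rewrite leUx => /andP[ap bnp]; have [pT prim] := pp.
have bp : b <= p.
  elim: n bnp => // n ih; rewrite comm_iterS => /prim[]; exact: ih.
by apply: pT; apply/le_anti; rewrite lex1 -abT leUx ap bp.
Qed.

(** Every congruence is the join of the principal congruences below it, so \top is
    the join of compact congruences below a or below b; finitely many of them
    suffice, and those below a and those below b are collected apart. *)
Lemma compact_cover A (a b : con A) : V A -> a `|` b = \top ->
  exists a' b', [/\ compact_con a', compact_con b', a' <= a, b' <= b
                  & a' `|` b' = \top].
Proof.
move=> VA abT.
pose S := [set c : con A | compact_con c /\ (c <= a \/ c <= b)].
have inS c : c = a \/ c = b -> c <= con_sup S.
  move=> cab; apply/con_leP => x y cxy.
  pose g := con_gen (fun u v : A => u = x /\ v = y).
  have gc : g <= c by apply/con_leP => u v; apply => _ _ [-> ->].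
  have Sg : S g.
    by split; [exact: compact_con_principal | case: cab gc => ->; [left | right]].
  by apply: con_leE (con_sup_ub Sg) _ => d; apply.
have TS : \top <= con_sup S by rewrite -abT leUx !inS; [| right | left].
have [s [sS sT]] := compact_con_top sdV VA TS.
suff [a' [b' [ka kb aa bb sab]]] : exists a' b', [/\ compact_con a',
    compact_con b', a' <= a, b' <= b & \join_(c <- s) c <= a' `|` b'].
  by exists a', b'; split=> //; apply/le_anti; rewrite lex1 (le_trans sT).
elim: s sS {sT} => [|c s ih] sS.
  by exists \bot, \bot; rewrite big_nil !le0x; split=> //; apply: compact_con_bot.
have [|a' [b' [ka kb aa bb sab]]] := ih.
  by move=> d ds; apply: sS; rewrite inE ds orbT.
have [|kc [ca|cb]] := sS c; first by rewrite inE eqxx.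
  exists (c `|` a'), b'; split=> //; first exact: compact_con_join.
    by rewrite leUx ca.
  by rewrite big_cons -joinA; apply: leU2.
exists a', (c `|` b'); split=> //; first exact: compact_con_join.
  by rewrite leUx cb.
by rewrite big_cons joinCA; apply: leU2.
Qed.

End CommutatorTheory.

(** * The bounds of the reticulation *)

Section ReticulationTop.
Variables (sg : signature) (V : variety sg).
Hypotheses (modV : congruence_modular V) (sdV : semidegenerate V).
Variables (C : con_operation sg) (CV : is_commutator V C).
Variables (A : algebra sg) (VA : V A) (kA : compact_closed C A).

Local Notation L := (reticulation sdV CV VA kA).
Local Notation lambda := (@ret_lambda _ V sdV C CV A VA kA).

Lemma lambda_join_top (a b : compact_sub A) :
  lambda a `|` lambda b = \top :> L <-> (a : con A) `|` b = \top.
Proof.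
change (ret_join (lambda a) (lambda b) = ret_top sdV CV VA kA <->
  (a : con A) `|` b = \top); rewrite ret_joinE.
split=> [/ret_lambdaP E|abT]; last by apply/ret_lambdaP => p _; rewrite /= abT.
apply: contrapT => /(prime_above modV sdV CV VA)[p pp abp].
have [pT _] := pp; apply: pT; apply/le_anti; rewrite lex1 /=.
by have /= <- := E p pp.
Qed.

Lemma lambda_meet_bot (a b : compact_sub A) :
  lambda a `&` lambda b = \bot :> L <->
  forall p, prime_con C p -> C (a : con A) b <= p.
Proof.
change (ret_meet (lambda a) (lambda b) = ret_bot sdV CV VA kA <->
  forall p, prime_con C p -> C (a : con A) b <= p); rewrite ret_meetE.
split=> [/ret_lambdaP E p pp|abp]; first by have /= -> := E p pp; apply: le0x.
by apply/ret_lambdaP => p pp /=; rewrite abp ?le0x.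
Qed.

End ReticulationTop.

(** * Congruence normality and normality of the reticulation *)

Theorem proposition8p3 (sg : signature) (V : variety sg)
    (modV : congruence_modular V) (sdV : semidegenerate V)
    (C : con_operation sg) (CV : is_commutator V C)
    (A : algebra sg) (VA : V A) (kA : compact_closed C A)
    (starA : condition_star C A) :
  congruence_normal C A <-> normal_lattice (reticulation sdV CV VA kA).
Proof.
split=> [normA|normL a b abT].
  elim/ret_ind => a; elim/ret_ind => b /(lambda_join_top modV) abT.
  have [e [f [aeT bfT ef0]]] := normA _ _ abT.
  have [a' [e' [_ ke aa ee aeT']]] := compact_cover sdV VA aeT.
  have [b' [f' [_ kf bb ff bfT']]] := compact_cover sdV VA bfT.
  exists (ret_lambda sdV CV VA kA (CompactCon ke)).
  exists (ret_lambda sdV CV VA kA (CompactCon kf)); split.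
  - apply/(lambda_join_top modV)/le_anti; rewrite lex1 -aeT'; exact: leU2.
  - apply/(lambda_join_top modV)/le_anti; rewrite lex1 -bfT'; exact: leU2.
  - apply/lambda_meet_bot => p _; apply: le_trans (comm_mono modV CV VA ee ff) _.
    by rewrite ef0 le0x.
have [a' [b' [ka kb aa bb abT']]] := compact_cover sdV VA abT.
have [|u [v]] := normL (ret_lambda sdV CV VA kA (CompactCon ka))
                       (ret_lambda sdV CV VA kA (CompactCon kb)).
  exact/(lambda_join_top modV).
elim/ret_ind: u => e; elim/ret_ind: v => f.
move=> [/(lambda_join_top modV)/= aeT /(lambda_join_top modV)/= bfT].
move=> /lambda_meet_bot efP.
have kef := kA _ _ (@compact_valP _ _ e) (@compact_valP _ _ f).
have [n efn] := radical_nilpotent modV CV VA kA kef efP.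
(* The n-th iterate of [e, f] with itself is [e, f]^(n+1). *)
have [m efm] := starA _ _ (@compact_valP _ _ e) (@compact_valP _ _ f) n.+1 isT.
exists (comm_iter C (e : con A) e m), (comm_iter C (f : con A) f m); split.
- apply: (join_comm_iter_top modV sdV CV _ VA); apply/le_anti.
  by rewrite lex1 -aeT leU2.
- apply: (join_comm_iter_top modV sdV CV _ VA); apply/le_anti.
  by rewrite lex1 -bfT leU2.
- by apply/eqP; rewrite -lex0 -efn -comm_iter_shift.
Qed.
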